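(* For all positive integers $n,\sigma$, $\mathit{SQ}_{\mathrm{op}}(n,\sigma)\le \left(\binom{\sigma}{2}+\frac{11}{6}\right)n$.
   Context: For a word $u$, $\mathrm{Alph}(u)$ is the set of letters occurring in $u$. Over a totally ordered alphabet, an order-preserving square is a word $uv$ with $u,v$ nonempty, $|u|=|v|$, and a strictly increasing bijection $f:\mathrm{Alph}(u)\to\mathrm{Alph}(v)$ such that $v[t]=f(u[t])$ for all $t$. $\mathit{SQ}_{\mathrm{op}}(n,\sigma)$ is the maximum, over all words $w$ of length $n$ over a totally ordered alphabet of size $\sigma$, of the number of subwords (contiguous factors) of $w$ that are order-preserving squares, counted as distinct words. *)

(* Defs.v *)
From mathcomp Require Import all_boot all_order all_algebra.

Set Implicit Arguments.
Unset Strict Implicit.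
Unset Printing Implicit Defensive.

Section OrderPreservingSquares.

Variables (d : Order.disp_t) (T : finOrderType d).
Implicit Types (u v w : seq T) (f : T -> T).

Definition Alph u : {set T} := [set x in u].

(* A map Alph u -> Alph v is represented by a total function on the alphabet,
   constrained only on Alph u. *)
Definition op_bijection u v f : bool :=
  [&& [forall x in Alph u, forall y in Alph u, (x < y)%O ==> (f x < f y)%O],
      dinjectiveb f (mem (Alph u)) & f @: Alph u == Alph v].

(* For size u = size v, the equation v = map f u says v[t] = f (u[t]) for all
   t. *)
Definition op_equivalent u v : bool :=
  (size u == size v) &&
  [exists f : {ffun T -> T}, op_bijection u v f && (v == map f u)].

(* The bound size w on the two halves only makes the quantifiers finite; see
   op_squareP. *)
Definition op_square w : bool :=
  [exists u : (size w).-bseq T, exists v : (size w).-bseq T,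
    [&& w == u ++ v, u != [::] :> seq T, v != [::] :> seq T
      & op_equivalent u v]].

Lemma op_bijectionP u v f :
  reflect [/\ {in Alph u &, {homo f : x y / (x < y)%O}},
              {in Alph u &, injective f} & f @: Alph u = Alph v]
          (op_bijection u v f).
Proof.
apply: (iffP and3P) => [[/forall_inP hf /dinjectiveP hi /eqP hb]|[hf hi hb]].
  split=> // x y xu yu; have /forall_inP/(_ y yu)/implyP := hf x xu; exact.
split; [|exact/dinjectiveP|exact/eqP].
by apply/forall_inP=> x xu; apply/forall_inP=> y yu; apply/implyP; apply: hf.
Qed.

Lemma op_squareP w :
  reflect (exists u v, [/\ w = u ++ v, u <> [::], v <> [::], size u = size v
             & exists2 f : T -> T, op_bijection u v f & v = map f u])
          (op_square w).
Proof.
apply: (iffP existsP) => [[u /existsP[v /and4P[/eqP wE /eqP u0 /eqP v0]]]|].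
  case/andP=> /eqP suv /existsP[f /andP[fb /eqP vE]].
  by exists u, v; split=> //; exists f.
case=> u [v [wE u0 v0 suv [f fb vE]]].
have su : size u <= size w by rewrite wE size_cat leq_addr.
have sv : size v <= size w by rewrite wE size_cat leq_addl.
exists (Bseq su); apply/existsP; exists (Bseq sv); apply/and4P; split=> /=.
- exact/eqP.
- exact/eqP.
- exact/eqP.
rewrite /op_equivalent suv eqxx /=; apply/existsP; exists (finfun f).
have ff : finfun f =1 f by move=> x; rewrite ffunE.
apply/andP; split; last by rewrite (eq_map ff) -vE.
case/op_bijectionP: fb => hf hi hb; apply/op_bijectionP; split.
- by move=> x y xu yu; rewrite !ffunE; apply: hf.
- by move=> x y xu yu; rewrite !ffunE; apply: hi.
- by rewrite -hb; apply: eq_imset.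
Qed.

Definition op_square_factors w : {set (size w).-bseq T} :=
  [set x : (size w).-bseq T | infix x w && op_square x].

End OrderPreservingSquares.

(* The ordinals 'I_sigma serve as the totally ordered alphabet of size sigma,
   which is unique up to order isomorphism. *)
Definition SQop (n sigma : nat) : nat :=
  \max_(w : n.-tuple 'I_sigma) #|op_square_factors w|.

(* Main.v *)
Require Import Defs.
From mathcomp Require Import all_boot all_order all_algebra.
From mathcomp Require Import zify.

(* An order-preserving square u (map f u) with u <> map f u has a letter a of u
   with f a outside u, because an increasing self-map of a finite chain is the
   identity.  The first occurrences of a and f a after the starting position are
   then at distance |u|, so the square is determined by its position and the set
   {a, f a}: there are at most C(sigma, 2) n of these.

   Squares u u are counted, following Brlek and Li, through Rauzy graphs: level k
   has the factors of length k as vertices and those of length k + 1 as edges.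
   Circuits of length at most k, represented by Lyndon words, are independent,
   so their number is at most #edges - #vertices + 1, and these bounds telescope
   to n.  The squares of a given Lyndon root c are sent injectively to the levels
   at which c is a circuit. *)

Set Implicit Arguments.
Unset Strict Implicit.
Unset Printing Implicit Defensive.

(** * Vertices and edges of a connected graph *)

Section ConnectedCard.

Variables (V E : eqType) (src tgt : E -> V).

(* Connectivity of the graph is phrased as: every cut that no edge of [B]
   crosses is trivial on [A].  Cuts are then determined by their coboundary and
   their value at [r], so [2 ^ #|A| <= 2 * 2 ^ #|B|]. *)
Lemma connected_size_leq (A : seq V) (B : seq E) (r : V) :
    uniq A ->
    (forall D : V -> bool, {in B, forall e, D (src e) = D (tgt e)} ->
       {in A, forall x, D x = D r}) ->
  size A <= (size B).+1.
Proof.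
move=> uA conn.
(* Edges of [B] may have endpoints outside [A]; a cut is [false] there. *)
pose ext (f : {ffun 'I_(size A) -> bool}) x :=
  [exists i, (tnth (in_tuple A) i == x) && f i].
have extE f i : ext f (tnth (in_tuple A) i) = f i.
  apply/existsP/idP => [[j /andP[/eqP/tuple_uniqP eji fj]]|fi].
    by rewrite -(eji uA).
  by exists i; rewrite eqxx.
pose cob f := (ext f r, [ffun e : 'I_(size B) =>
  ext f (src (tnth (in_tuple B) e)) (+) ext f (tgt (tnth (in_tuple B) e))]).
have cob_inj : injective cob.
  move=> f g [fgr fge].
  (* The sum of two cuts with equal coboundary is crossed by no edge of [B], so it is constant on
     [A]; equal values at [r] make that constant [false]. *)
  pose D x := ext f x (+) ext g x.
  have DB : {in B, forall e, D (src e) = D (tgt e)}.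
    move=> e eB; have /tnthP[j ej] : e \in in_tuple B by [].
    have /ffunP/(_ j) := fge; rewrite !ffunE -ej /D.
    by case: (ext f _) (ext f _) (ext g _) (ext g _) => [] [] [] [].
  apply/ffunP => i; rewrite -!extE.
  have /(_ _ (mem_tnth i (in_tuple A))) := conn D DB.
  rewrite /D fgr addbb.
  by case: (ext f _) (ext g _) => [] [].
have := leq_card cob cob_inj.
rewrite card_prod !card_ffun !card_ord card_bool -expnS leq_exp2l //.
Qed.

End ConnectedCard.

(** * Factors of periodic words *)

Section PeriodicWords.

Variables (T : eqType) (x0 : T).
Implicit Types c s : seq T.

(* The factor of length [l] at offset [t] of the infinite word c c c ... *)
Definition pfactor c t l := mkseq (fun i => nth x0 c ((t + i) %% size c)) l.

Lemma size_pfactor c t l : size (pfactor c t l) = l.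
Proof. exact: size_mkseq. Qed.

Lemma nth_pfactor c t l i :
  i < l -> nth x0 (pfactor c t l) i = nth x0 c ((t + i) %% size c).
Proof. by move=> il; rewrite nth_mkseq. Qed.

Lemma pfactor_eqmod c t t' l :
  t = t' %[mod size c] -> pfactor c t l = pfactor c t' l.
Proof. by move=> tt'; apply: eq_mkseq => i; rewrite -modnDml tt' modnDml. Qed.

Lemma take_drop_pfactor c t l i j : i + j <= l ->
  take j (drop i (pfactor c t l)) = pfactor c (t + i) j.
Proof.
move=> ijl; have sz : size (take j (drop i (pfactor c t l))) = j.
  by rewrite size_takel // size_drop size_pfactor leq_subRL; lia.
apply: (@eq_from_nth _ x0); rewrite ?size_pfactor // sz => h hj.
by rewrite nth_take // nth_drop !nth_pfactor ?addnA //; lia.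
Qed.

Lemma infix_pfactor c t l i j :
  i + j <= l -> infix (pfactor c (t + i) j) (pfactor c t l).
Proof.
move=> ijl; rewrite -(take_drop_pfactor c t ijl).
exact: infix_trans (infix_take _ _) (infix_drop _ _).
Qed.

Lemma take_pfactor c t l j : j <= l -> take j (pfactor c t l) = pfactor c t j.
Proof.
by move=> jl; rewrite -[pfactor c t l]drop0 take_drop_pfactor ?add0n ?addn0.
Qed.

Lemma behead_pfactor c t l : behead (pfactor c t l.+1) = pfactor c t.+1 l.
Proof.
rewrite -drop1 -[drop 1 _](@take_size) size_drop size_pfactor subSS subn0.
by rewrite take_drop_pfactor ?addn1 ?add1n.
Qed.

Lemma pfactor_rot c t : t <= size c -> pfactor c t (size c) = rot t c.
Proof.
move=> tc; apply: (@eq_from_nth _ x0); rewrite ?size_pfactor ?size_rot // => i ic.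
rewrite nth_pfactor // /rot nth_cat size_drop.
case: ltnP => h; first by rewrite nth_drop modn_small //; lia.
rewrite nth_take; last by lia.
congr nth; have -> : t + i = (i - (size c - t)) + size c by lia.
by rewrite modnDr modn_small; lia.
Qed.

Lemma pfactor_id c : pfactor c 0 (size c) = c.
Proof. by rewrite pfactor_rot // rot0. Qed.

Lemma pfactor_conj c t : pfactor c t (size c) = rot (t %% size c) c.
Proof.
case: c => [//|x c]; rewrite -pfactor_rot; last by rewrite ltnW ?ltn_pmod.
by apply: pfactor_eqmod; rewrite modn_mod.
Qed.

Lemma pfactor_square c : pfactor c 0 (size c + size c) = c ++ c.
Proof.
rewrite -[LHS](cat_take_drop (size c)) take_pfactor ?leq_addr // pfactor_id.
rewrite -[drop _ _](@take_size) size_drop size_pfactor addnK.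
rewrite take_drop_pfactor // add0n; congr cat.
by rewrite pfactor_rot // rot_size.
Qed.

Lemma pfactor_pfactor c r t l : 0 < size c ->
  pfactor (pfactor c r (size c)) t l = pfactor c (r + t) l.
Proof.
move=> c0; apply: eq_mkseq => i; rewrite size_pfactor nth_pfactor ?ltn_pmod //.
by rewrite modnDmr addnA.
Qed.

End PeriodicWords.

(** * Lyndon words and Lyndon roots *)

Section Lyndon.

Variables (d : Order.disp_t) (T : finOrderType d) (x0 : T).
Import Order.TTheory.
Implicit Types c s : seq T.

Local Notation "s1 <l s2" := ((s1 : seqlexi T) < (s2 : seqlexi T))%O
  (at level 70).

Lemma ltxi_cat2l s s1 s2 : (s ++ s1 <l s ++ s2) = (s1 <l s2).
Proof. by elim: s => // x s <-; rewrite !cat_cons ltxi_cons lexx. Qed.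

Lemma ltxi_cat2r s s1 s2 : size s1 = size s2 ->
  (s1 ++ s <l s2 ++ s) = (s1 <l s2).
Proof.
elim: s1 s2 => [|x s1 IH] [|y s2] //.
by case=> /IH; rewrite !cat_cons !ltxi_cons => ->.
Qed.

Definition lyndon c : bool :=
  (0 < size c) && [forall t : 'I_(size c), (0 < t) ==> (c <l rot t c)].

Lemma lyndonP c : reflect (0 < size c /\
  forall t, 0 < t < size c -> c <l rot t c) (lyndon c).
Proof.
apply: (iffP andP) => -[c0 H]; split=> //.
  move=> t /andP[t0 tc]; have /forallP/(_ (Ordinal tc))/implyP := H; exact.
by apply/forallP => t; apply/implyP => t0; apply: H; rewrite t0 ltn_ord.
Qed.

(** A period [h] gives a border [x], with [c = p x = x q]. Comparing [c] with its rotation [x p]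
    yields [q < p], and with its rotation [q x] yields [p < q]. *)
Lemma lyndon_unbordered c h : lyndon c -> 0 < h < size c ->
  ~ (forall i, i + h < size c -> nth x0 c (i + h) = nth x0 c i).
Proof.
case/lyndonP=> c0 H /andP[h0 hc] per.
have xE : drop h c = take (size c - h) c.
  apply: (@eq_from_nth _ x0); first by rewrite size_drop size_takel // leq_subr.
  by move=> i; rewrite size_drop => ic; rewrite nth_drop nth_take // addnC per //; lia.
have := H h; rewrite h0 hc /rot xE => /(_ isT).
rewrite -{1}(cat_take_drop (size c - h) c) ltxi_cat2l.
have : c <l rot (size c - h) c by apply: H; lia.
rewrite /rot -xE -{1}(cat_take_drop h c) ltxi_cat2r; last first.
  by rewrite size_drop size_takel; lia.
by move=> /lt_trans h1 /h1; rewrite ltxx.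
Qed.

Lemma lyndon_conj c t : t < size c -> lyndon c -> lyndon (rot t c) -> rot t c = c.
Proof.
case: t => [|t]; first by rewrite rot0.
move=> tc /lyndonP[_ H] /lyndonP[_ H'].
have : rot t.+1 c <l rot (size c - t.+1) (rot t.+1 c).
  by apply: H'; rewrite size_rot; lia.
rewrite -(size_rot t.+1 c) -/(rotr _ _) rotK => /lt_trans/(_ (H t.+1 tc)).
by rewrite ltxx.
Qed.

(** At equal lengths [c] and [c'] are conjugate Lyndon words; otherwise [c'] inherits the proper
    period [size c] and has a border. *)
Lemma lyndon_prefix_eq c c' t k : lyndon c -> lyndon c' ->
  size c <= size c' <= k -> pfactor x0 c' 0 k = pfactor x0 c t k -> c' = c.
Proof.
move=> lc lc' /andP[scc' sk] /(congr1 (take (size c'))).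
rewrite !take_pfactor // pfactor_id => c'E.
have [c0 _] := lyndonP _ lc.
move: scc'; rewrite leq_eqVlt => /predU1P[scc'|scc'].
  rewrite -scc' pfactor_conj in c'E.
  by rewrite c'E in lc' *; apply: lyndon_conj => //; rewrite ltn_pmod.
case: (@lyndon_unbordered c' (size c)) => // [|i ic']; first by rewrite c0.
by rewrite c'E !nth_pfactor ?addnA ?modnDr //; rewrite -?c'E; lia.
Qed.

(** Let [m] be the least period of [u u u ...]. It divides [size u], since a nonzero remainder would
    be a smaller period. The first [m] letters form a primitive word, whose least rotation is the
    root. *)
Lemma lyndon_root u : 0 < size u -> exists c t,
  [/\ lyndon c, size c %| size u & forall l, pfactor x0 u 0 l = pfactor x0 c t l].
Proof.
move=> u0; pose g i := nth x0 u (i %% size u).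
pose P m := (0 < m) && [forall i : 'I_(size u), g (i + m) == g i].
have PP m : reflect (0 < m /\ forall i, g (i + m) = g i) (P m).
  apply: (iffP andP) => -[m0 H]; split=> //; last first.
    by apply/forallP => i; rewrite H.
  move=> i; have /forallP/(_ (Ordinal (ltn_pmod i u0)))/eqP := H.
  by rewrite /g /= modnDml modn_mod.
have exP : exists m, P m.
  by exists (size u); apply/PP; split=> // i; rewrite /g modnDr.
case: (ex_minnP exP) => m /PP[m0 gm] minm.
have gmn i j : g (i + j * m) = g i.
  by elim: j => [|j IH]; rewrite ?addn0 // mulSn addnCA addnC gm.
have gmod i : g (i %% m) = g i by rewrite [in RHS](divn_eq i m) addnC gmn.
have mu : m %| size u.
  rewrite /dvdn; case: posnP => // r0.
  have /minm : P (size u %% m); last by rewrite leqNgt ltn_pmod.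
  apply/PP; split=> // i; rewrite -(gmn _ (size u %/ m)) -addnA [_ %% m + _]addnC.
  by rewrite -divn_eq /g modnDr.
pose x := mkseq g m; have sx : size x = m by rewrite size_mkseq.
have xE l : pfactor x0 u 0 l = pfactor x0 x 0 l.
  by apply: eq_mkseq => i; rewrite sx nth_mkseq ?ltn_pmod // gmod.
have xprim t : 0 < t < m -> rot t x <> x.
  case/andP=> t0 tm rx; have /minm : P t; last by rewrite leqNgt tm.
  apply/PP; split=> // i; rewrite -[RHS]gmod -gmod.
  rewrite -(@nth_mkseq _ x0 g m (i %% m)) ?ltn_pmod // -/x -{1}rx.
  rewrite -(pfactor_rot x0) ?sx ?(ltnW tm) // nth_pfactor ?ltn_pmod //.
  by rewrite sx nth_mkseq ?ltn_pmod // modnDmr addnC.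
(* Primitivity [xprim] makes minimality strict, as [lyndon] demands; the offset [m - r] undoes the
   rotation by [r]. *)
have [r rm] := @arg_minP _ _ 'I_m (Ordinal m0) xpredT
  (fun i => rot i x : seqlexi T) isT.
move=> minr; exists (rot r x), (m - r); split; last 2 first.
- by rewrite size_rot sx.
- move=> l; rewrite xE -(pfactor_rot x0) ?sx ?(ltnW (ltn_ord r)) //.
  rewrite -{2}sx pfactor_pfactor ?sx // subnKC ?(ltnW (ltn_ord r)) //.
  by apply: pfactor_eqmod; rewrite sx modnn mod0n.
apply/lyndonP; rewrite size_rot sx; split=> // t /andP[t0 tm].
rewrite lt_neqAle; apply/andP; split.
  apply/negP => /eqP; rewrite rot_rot => /rot_inj/esym.
  by apply: xprim; rewrite t0.
have -> : rot t (rot r x) = rot ((r + t) %% m) x.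
  rewrite -(pfactor_rot x0) ?size_rot ?sx ?(ltnW tm) //.
  rewrite -(pfactor_rot x0) ?sx ?(ltnW (ltn_ord r)) //.
  have /esym := pfactor_conj x0 x (r + t).
  by have := @pfactor_pfactor _ x0 x r t m; rewrite sx => /(_ m0) -> ->.
exact: (minr (Ordinal (ltn_pmod (r + t) m0))).
Qed.

End Lyndon.

(** * Factors of a fixed length *)

Section Factors.

Variable T : eqType.
Implicit Types w x : seq T.

Definition factors w k : seq (seq T) :=
  undup [seq take k (drop i w) | i <- iota 0 ((size w).+1 - k)].

Lemma factorsP w k x : reflect (size x = k /\ infix x w) (x \in factors w k).
Proof.
rewrite mem_undup; apply: (iffP mapP) => [[i]|[xk /infixP[p [s wE]]]].
  rewrite mem_iota => iw ->; split; last first.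
    exact: infix_trans (infix_take _ _) (infix_drop _ _).
  by rewrite size_takel // size_drop; lia.
exists (size p); last by rewrite wE drop_size_cat // -xk take_size_cat.
by rewrite mem_iota wE !size_cat; lia.
Qed.

Lemma factors_uniq w k : uniq (factors w k). Proof. exact: undup_uniq. Qed.

(** Sliding a window of length [k] along [w] from its prefix crosses one edge per letter, so the
    Rauzy graph is connected. *)
Lemma factors_ind (D : seq T -> bool) w k : k <= size w ->
    {in factors w k.+1, forall e, D (take k e) = D (behead e)} ->
  {in factors w k, forall x, D x = D (take k w)}.
Proof.
move=> kw De x; rewrite mem_undup => /mapP[i].
rewrite mem_iota add0n subSn // ltnS => /andP[_ iw] -> {x}.
elim: i iw => [|i IH] iw; first by rewrite drop0.
rewrite -IH; last by lia.
have /De : take k.+1 (drop i w) \in factors w k.+1.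
  by rewrite mem_undup; apply/mapP; exists i => //; rewrite mem_iota; lia.
rewrite take_takel // => ->; congr D.
case E: (drop i w) => [|y s] /=; last first.
  by rewrite -[i.+1]add1n -drop_drop E /= drop0.
by have := congr1 size E; rewrite size_drop /=; lia.
Qed.

End Factors.

(** * Counting distinct squares *)

Section Squares.

Variables (d : Order.disp_t) (T : finOrderType d) (x0 : T).
Implicit Types c s w : seq T.

(* [c], up to conjugacy, is a circuit of length at most [k] in the Rauzy graph
   of [w], whose vertices and edges are the factors of length [k] and [k.+1]. *)
Definition rauzy_circuit w k c : Prop :=
  [/\ lyndon c, size c <= k & forall t, infix (pfactor x0 c t k.+1) w].

(* The edge of the circuit [c] that starts with the unbordered word [c] lies on
   no other circuit of length at most [size c]; deleting all these edges, longest
   circuits first, therefore keeps the graph connected. *)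
Lemma rauzy_circuits_leq w k (C : seq (seq T)) : k <= size w -> uniq C ->
    (forall c, c \in C -> rauzy_circuit w k c) ->
  size (factors w k) + size C <= (size (factors w k.+1)).+1.
Proof.
move=> kw uC circC; pose edge c := pfactor x0 c 0 k.+1.
have edge_eq c c' t : c \in C -> c' \in C -> size c <= size c' ->
    edge c' = pfactor x0 c t k.+1 -> c' = c.
  move=> /circC[lc _ _] /circC[lc' c'k _] scc'.
  by apply: lyndon_prefix_eq => //; rewrite scc' leqW.
have edge_inj : {in C &, injective edge}.
  move=> c c' cC c'C ecc'; case/orP: (leq_total (size c) (size c')) => scc'.
    by apply/esym/(edge_eq _ _ 0).
  exact: (edge_eq _ _ 0).
have factor_edge c t : c \in C -> pfactor x0 c t k.+1 \in factors w k.+1.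
  by move=> /circC[_ _ cw]; apply/factorsP; rewrite size_pfactor.
pose M := map edge C.
pose B := [seq e <- factors w k.+1 | e \notin M].
have sM : size C = size [seq e <- factors w k.+1 | e \in M].
  rewrite -(size_map edge); apply/perm_size/uniq_perm.
  - by rewrite map_inj_in_uniq.
  - by rewrite filter_uniq ?factors_uniq.
  move=> e; rewrite mem_filter andb_idr // => /mapP[c cC ->].
  exact: factor_edge.
have -> : (size (factors w k.+1)).+1 = (size B).+1 + size C.
  by rewrite sM !size_filter -(count_predC (mem M)) addSn addnC.
rewrite leq_add2r.
apply: (connected_size_leq (src := take k) (tgt := behead) (r := take k w)).
  exact: factors_uniq.
move=> D DB; apply: factors_ind => // e eF.
have [/mapP[c cC ->]|eM] := boolP (e \in M); last first.
  by apply: DB; rewrite mem_filter eM.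
have [m] := ubnP (size c).
elim: m c cC => // m IH c cC; rewrite ltnS => cm.
have [lc ck _] := circC _ cC; have [c0 rotc] := lyndonP _ lc.
(* The rest of the circuit joins the endpoints of the deleted edge of [c]. If one of its edges is
   deleted too, it starts a strictly shorter circuit, covered by induction. *)
have step t : 0 < t < size c ->
    D (pfactor x0 c t k) = D (pfactor x0 c t.+1 k).
  move=> tc; rewrite -behead_pfactor -(take_pfactor x0 c t (leqnSn k)).
  have [/mapP[c' c'C ec']|eM'] := boolP (pfactor x0 c t k.+1 \in M); last first.
    by apply: DB; rewrite mem_filter eM' factor_edge.
  rewrite ec'; apply: IH => //; apply: leq_trans cm; rewrite ltnNge.
  apply/negP => /edge_eq => /(_ t cC c'C (esym ec')) cc'.
  move: ec'; rewrite cc' => /(congr1 (take (size c))).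
  rewrite !take_pfactor ?(leqW ck) // pfactor_id pfactor_rot; last by lia.
  by move=> rc; have := rotc t tc; rewrite rc Order.POrderTheory.ltxx.
have walk t : t < size c -> D (pfactor x0 c 1 k) = D (pfactor x0 c t.+1 k).
  elim: t => // t IHt tc; rewrite IHt; last by lia.
  by rewrite step //; lia.
rewrite take_pfactor // behead_pfactor (walk (size c).-1) prednK //.
by congr D; apply: pfactor_eqmod; rewrite modnn mod0n.
Qed.

Definition is_square s : bool :=
  (0 < size s) && (take (size s)./2 s == drop (size s)./2 s).

(** The doubled length makes each half of [s] a power of a conjugate of [c]. *)
Definition lyndon_root_of s c : bool :=
  [&& lyndon c, (size c).*2 %| size s &
      [exists t : 'I_(size c), s == pfactor x0 c t (size s)]].

Definition sqroot s : seq T :=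
  oapp (fun c : (size s).-bseq T => c : seq T) [::]
    [pick c : (size s).-bseq T | lyndon_root_of s c].

Lemma sqrootP s : is_square s -> lyndon_root_of s (sqroot s).
Proof.
case/andP=> s0 /eqP suu; set u := take _ s in suu.
have sE : s = u ++ u by rewrite {2}suu cat_take_drop.
have u0 : 0 < size u by move: s0; rewrite sE size_cat; lia.
have [c [t [lc cu cE]]] := lyndon_root x0 u0.
have [c0 _] := lyndonP _ lc.
rewrite /sqroot; case: pickP => [c' //|/(_ (insub_bseq (size s) c))].
have cs : size c <= size s.
  by have := dvdn_leq u0 cu; rewrite sE size_cat; lia.
rewrite /insub_bseq insubdK // => /negP[]; apply/and3P; split=> //.
  by rewrite sE size_cat addnn -!muln2 dvdn_pmul2r.
apply/existsP; exists (Ordinal (ltn_pmod t c0)) => /=.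
rewrite {1}sE -(pfactor_square x0) cE sE size_cat; apply/eqP.
by apply: pfactor_eqmod; rewrite modn_mod.
Qed.

Section Bound.

Variables (w : seq T) (S : seq (seq T)).
Hypotheses (uS : uniq S) (sqS : {in S, forall s, is_square s})
  (wS : {in S, forall s, infix s w}).

Let mates s := [seq s' <- S | (size s' == size s) && (sqroot s' == sqroot s)].

(** Half-lengths are multiples of the root length, and ranks among mates stay below it ([rank_lt]).
    Squares with the same root and different lengths thus use disjoint ranges of levels. *)
Let level s := (size s)./2 + index s (mates s).

Let mates_mem s : s \in S -> s \in mates s.
Proof. by move=> sS; rewrite mem_filter !eqxx. Qed.

Let matesP s s' : s' \in mates s ->
  exists t, s' = pfactor x0 (sqroot s) t (size s).
Proof.
rewrite mem_filter => /andP[/andP[/eqP ss' /eqP rs'] /sqS/sqrootP].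
case/and3P=> _ _ /existsP[t /eqP s'E].
by exists t; rewrite -rs' -ss'.
Qed.

(** A mate is determined by its offset modulo the length of the root. *)
Let rank_lt s : s \in S -> index s (mates s) < size (sqroot s).
Proof.
move=> sS; have := mates_mem sS; rewrite -index_mem => /leq_trans; apply.
have /sqrootP/and3P[/lyndonP[c0 _] _ _] := sqS sS.
rewrite -[leqRHS](size_iota 0).
rewrite -(size_map (fun t => pfactor x0 (sqroot s) t (size s))).
apply: uniq_leq_size => [|s' /matesP[t ->]]; first exact: filter_uniq.
apply/mapP; exists (t %% size (sqroot s)); first by rewrite mem_iota ltn_pmod.
by apply: pfactor_eqmod; rewrite modn_mod.
Qed.

Let size_sqroot s : s \in S ->
  exists j, size s = (j.+1 * size (sqroot s)).*2.
Proof.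
move=> sS; have /andP[s0 _] := sqS sS.
have /sqrootP/and3P[_ /dvdnP[[|j] sE] _] := sqS sS.
  by rewrite sE in s0.
by exists j; rewrite sE doubleMr.
Qed.

(* If the factor at offset [t] is missing, every mate of [s] starts at one of the
   [index s (mates s)] offsets following [t]: too few for the mates preceding
   [s] together with [s] itself. *)
Let level_circuit s : s \in S -> rauzy_circuit w (level s) (sqroot s).
Proof.
move=> sS; set c := sqroot s.
have /sqrootP/and3P[lc _ _] := sqS sS; have [c0 _] := lyndonP _ lc.
have := rank_lt sS; have [j] := size_sqroot sS; rewrite -/c => sE.
rewrite /level -/c sE doubleK; set i := index _ _ => ic.
split=> // [|t]; first by rewrite mulSn -addnA leq_addr.
apply/negPn/negP => tw.
have : index s (mates s) < size (mates s) by rewrite index_mem mates_mem.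
rewrite -/i ltnNge => /negP[].
rewrite -(size_iota 1 i) -(size_map (fun h => pfactor x0 c (t + h) (size s))).
apply: uniq_leq_size => [|s' s'm]; first exact: filter_uniq.
have s'w : infix s' w by move: s'm; rewrite mem_filter => /andP[_ /wS].
have [t' s'E] := matesP s'm.
(* This is [t' - t] modulo [size c], avoiding truncated subtraction. *)
pose h := (t' + (size c - t %% size c)) %% size c.
have hc : h < size c by rewrite ltn_pmod.
have {}s'E : s' = pfactor x0 c (t + h) (size s).
  have tE : t + (size c - t %% size c) = (t %/ size c).+1 * size c.
    by have := divn_eq t (size c); have := ltn_pmod t c0; rewrite mulSn; lia.
  by rewrite s'E; apply: pfactor_eqmod; rewrite modnDmr addnCA tE addnC modnMDl.
apply/mapP; exists h => //; rewrite mem_iota add1n.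
case: (posnP h) => h0 /=.
  case/negP: tw; apply: infix_trans s'w; rewrite s'E h0 addn0.
  have := @infix_pfactor _ x0 c t (size s) 0 (j.+1 * size c + i).+1.
  by rewrite addn0; apply; rewrite sE mulSn; lia.
rewrite ltnS leqNgt; apply/negP => ih; case/negP: tw.
apply: infix_trans s'w; rewrite s'E.
(* Offset [t] recurs [size c - h] letters into [s']; since [i < h], the missing factor still fits
   before the end of [s']. *)
rewrite (_ : pfactor x0 c t _ =
    pfactor x0 c (t + h + (size c - h)) (j.+1 * size c + i).+1); last first.
  by apply: pfactor_eqmod; rewrite -addnA subnKC ?modnDr // ltnW.
by apply: infix_pfactor; rewrite sE mulSn; lia.
Qed.

Let level_inj : {in S &, injective (fun s => (sqroot s, level s))}.
Proof.
move=> s s' sS s'S [rE lE].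
have [j sE] := size_sqroot sS; have [j' s'E] := size_sqroot s'S.
have ri := rank_lt sS; have ri' := rank_lt s'S; rewrite -rE in s'E ri'.
move: lE; rewrite /level sE s'E !doubleK => lE.
have c0 : 0 < size (sqroot s) by case: (size _) ri.
have jj' : j = j'.
  have := congr1 (divn^~ (size (sqroot s))) lE.
  by rewrite !divnMDl // !divn_small // !addn0 => -[].
have mE : mates s' = mates s.
  by apply: eq_filter => x; rewrite sE s'E rE jj'.
move: lE; rewrite jj' mE => /addnI iE.
by rewrite -(nth_index [::] (mates_mem sS)) iE nth_index // -mE mates_mem.
Qed.

Lemma distinct_squares_leq : size S <= size w.
Proof.
pose C k := [seq sqroot s | s <- S & level s == k].
have sC k : k < size w ->
    size (factors w k) + size (C k) <= (size (factors w k.+1)).+1.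
  move=> kw; apply: rauzy_circuits_leq (ltnW kw) _ _.
    rewrite map_inj_in_uniq ?filter_uniq // => s s'.
    rewrite !mem_filter => /andP[/eqP ls sS] /andP[/eqP ls' s'S] rE.
    by apply: level_inj => //; rewrite rE ls ls'.
  move=> c /mapP[s]; rewrite mem_filter => /andP[/eqP <- sS] ->.
  exact: level_circuit.
(* The inequalities [sC] telescope; the [1] on the left is the empty word, the only factor at level
   [0]. *)
have sumC m : m <= size w ->
    \sum_(k < m) size (C k) + 1 <= size (factors w m) + m.
  elim: m => [_|m IH mw].
    by rewrite big_ord0 addn0 add0n -has_predT; apply/hasP; exists [::] => //;
      apply/factorsP; rewrite infix0s.
  rewrite big_ord_recr /= addnAC.
  apply: leq_trans (leq_add (IH (ltnW mw)) (leqnn _)) _.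
  by rewrite addnAC addnS -addSn leq_add2r sC.
have -> : size S = \sum_(k < size w) size (C k).
  under eq_bigr do rewrite size_map size_filter -sum1_count big_mkcond.
  rewrite exchange_big /= -sum1_size big_seq [RHS]big_seq.
  apply: eq_bigr => s sS; have lw : level s < size w.
    have [_ _ /(_ 0)/size_infix] := level_circuit sS.
    by rewrite size_pfactor.
  rewrite (bigD1 (Ordinal lw)) //= eqxx big1 ?addn0 // => k.
  by rewrite -val_eqE /= eq_sym => /negPf ->.
have := sumC _ (leqnn _).
have : size (factors w (size w)) <= 1.
  apply: leq_trans (size_undup _) _.
  by rewrite size_map size_iota subSnn.
by lia.
Qed.

End Bound.

End Squares.

(** * Order-preserving squares that are not squares *)

Section NontrivialSquares.

Variables (d : Order.disp_t) (T : finOrderType d).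
Import Order.TTheory.
Implicit Types u v w : seq T.

Lemma index_map_in (T1 T2 : eqType) (f : T1 -> T2) (s : seq T1) x :
  {in s &, injective f} -> x \in s -> index (f x) (map f s) = index x s.
Proof.
elim: s => //= y s IH f_inj; rewrite inE.
have [-> _|neq_xy /= xs] := eqVneq x y; first by rewrite !eqxx.
case: eqP => [/f_inj fyx|_].
  by rewrite fyx ?eqxx ?inE ?eqxx ?xs ?orbT // in neq_xy.
by rewrite IH // => a b aS bS; apply: f_inj; rewrite inE ?aS ?bS orbT.
Qed.

(** By cardinality [f] permutes [A], so it maps the sorted enumeration of [A] to a sorted list of
    the same elements, hence to itself. *)
Lemma increasing_stable_id (A : {set T}) (f : T -> T) :
    {in A &, {homo f : x y / (x < y)%O}} -> {in A &, injective f} ->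
    {in A, forall x, f x \in A} ->
  {in A, f =1 id}.
Proof.
move=> f_lt f_inj fA; pose s := sort <=%O (enum A).
have sA x : (x \in s) = (x \in A) by rewrite mem_sort mem_enum.
have s_lt : sorted <%O s by rewrite sort_lt_sorted enum_uniq.
have fAE : f @: A = A.
  apply/eqP; rewrite eqEcard card_in_imset // leqnn andbT.
  by apply/subsetP => _ /imsetP[x xA ->]; apply: fA.
have fs : map f s = s.
  apply: lt_sorted_eq => //.
    by apply: (homo_sorted_in f_lt) s_lt; apply/allP => x; rewrite sA.
  move=> x; rewrite sA -fAE; apply/mapP/imsetP => -[y yA ->]; exists y => //.
    by rewrite -sA.
  by rewrite sA.
move=> x xA; rewrite -sA in xA.
by have /eq_in_map -> : map f s = map id s by rewrite map_id.
Qed.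

Lemma op_bijection_new_letter u v f :
    op_bijection u v f -> v = map f u -> u <> v ->
  exists2 a, a \in u & f a \notin u.
Proof.
case/op_bijectionP=> f_lt f_inj _ vE uv; apply/hasP/negPn/negP => /hasPn fu.
case: uv; rewrite vE -[LHS]map_id; apply/esym/eq_in_map => x xu.
apply: (increasing_stable_id f_lt f_inj) => [y|]; rewrite !inE //.
by move/fu; rewrite negbK.
Qed.

(* With [A = {a, b}] this is the factor at [i] whose half-length is the distance
   between the first occurrences of [a] and [b] after [i]: the double sum has one
   term that truncated subtraction does not kill. *)
Definition letter_gap_factor w (i : nat) (A : {set T}) : seq T :=
  take (\sum_(a in A) \sum_(b in A) (index a (drop i w) - index b (drop i w))).*2
    (drop i w).

Lemma nontrivial_op_square w x : infix x w -> op_square x -> ~~ is_square x ->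
  exists2 i, i < size w & exists2 A : {set T}, #|A| == 2 &
    x = letter_gap_factor w i A.
Proof.
case/infixP=> p [s wE] /op_squareP[u [v [xE u0 v0 suv [f fb vE]]]] nsq.
have uv : u <> v.
  move=> uv; case/negP: nsq; rewrite /is_square xE -uv size_cat addnn doubleK.
  by rewrite take_size_cat // drop_size_cat // eqxx andbT; case: (u) u0.
have [a au fau] := op_bijection_new_letter fb vE uv.
have [_ f_inj _] := op_bijectionP _ _ _ fb.
have af : a != f a by apply: contraNneq fau => <-.
exists (size p).
  by rewrite wE xE !size_cat; case: (u) u0 => //= *; lia.
exists [set a; f a]; first by rewrite cards2 af.
have dE : drop (size p) w = u ++ v ++ s by rewrite wE drop_size_cat // xE catA.
(* As [f a] is absent from [u], its first occurrence lies in [v], at the position that [a] has in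
   [u]; the gap is [size u]. *)
have ia : index a (u ++ v ++ s) = index a u by rewrite index_cat au.
have ib : index (f a) (u ++ v ++ s) = size u + index a u.
  rewrite index_cat (negPf fau) index_cat vE map_f // index_map_in //.
  by move=> y z yu zu; apply: f_inj; rewrite inE.
rewrite /letter_gap_factor dE !big_setU1 ?inE //= !big_set1.
rewrite !big_setU1 ?inE //= !big_set1 ia ib !subnn addn0 add0n addnK.
rewrite (_ : _ - _ = 0) ?add0n; last by lia.
by rewrite catA take_size_cat // size_cat -suv addnn.
Qed.

Lemma card_op_square_factors w :
  #|op_square_factors w| <= ('C(#|T|, 2) + 1) * size w.
Proof.
(* The empty word is set apart because periodic factors need a default letter [x0]. *)
case wE: w => [|x0 w']; first rewrite muln0 leqn0.
  rewrite cards_eq0; apply/eqP/setP => x; rewrite !inE infixs0.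
  apply/negP => /andP[/eqP -> /op_squareP[u [v [uv u0 _ _]]]].
  by case: u u0 uv.
rewrite -wE {w' wE}.
rewrite -(cardsID [set x : (size w).-bseq T | is_square x]) mulnDl mul1n addnC.
apply: leq_add; last first.
  rewrite cardE -(size_map (fun x : (size w).-bseq T => x : seq T)).
  apply: (distinct_squares_leq x0).
  - by rewrite map_inj_uniq ?enum_uniq //; apply: val_inj.
  - by move=> _ /mapP[x xS ->]; move: xS; rewrite mem_enum !inE => /andP[].
  - by move=> _ /mapP[x xS ->]; move: xS; rewrite mem_enum !inE => /andP[/andP[]].
pose g (q : 'I_(size w) * {set T}) :=
  insub_bseq (size w) (letter_gap_factor w q.1 q.2).
pose Q := setX [set: 'I_(size w)] [set A : {set T} | #|A| == 2].
have <- : #|Q| = 'C(#|T|, 2) * size w.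
  by rewrite cardsX cardsT card_ord card_draws mulnC.
apply: leq_trans (leq_imset_card g Q); apply/subset_leq_card/subsetP => x.
rewrite !inE => /andP[nsq /andP[xw opx]].
have [i iw [A A2 xE]] := nontrivial_op_square xw opx nsq.
apply/imsetP; exists (Ordinal iw, A); first by rewrite !inE.
apply: val_inj; rewrite /g /insub_bseq insubdK -?xE //.
exact: size_bseq.
Qed.

End NontrivialSquares.

(** * The bound over the rationals *)

Import Order.TTheory GRing.Theory Num.Theory.

Theorem theorem19 (n sigma : nat) (hn : (0 < n)%N) (hsigma : (0 < sigma)%N) :
  ((SQop n sigma)%:R <= (('C(sigma, 2))%:R + 11%:R / 6%:R) * n%:R :> rat)%R.
Proof.
have SQ_leq : SQop n sigma <= ('C(sigma, 2) + 1) * n.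
  apply/bigmax_leqP => w _; apply: leq_trans (card_op_square_factors w) _.
  by rewrite card_ord size_tuple.
apply: (@le_trans _ _ (('C(sigma, 2) + 1) * n)%:R%R).
  by rewrite ler_nat.
(* What remains is [1 <= 11 / 6]. *)
by rewrite natrM natrD ler_wpM2r ?ler0n // lerD2l.
Qed.
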